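(* Let $p$ be an odd prime and let $g \in \mathbb{F}_p[x]$ be a polynomial of degree at most $p-1$, regarded as a function $g\colon \mathbb{F}_p \to \mathbb{F}_p$. For $i \in \mathbb{F}_p$ let $\tilde g(i) \in \{0,1,\ldots,p-1\} \subset \mathbb{Z}$ denote the integer representative of $g(i)$. If $\sum_{i \in \mathbb{F}_p} \tilde g(i) = p$ as an equality of integers, then either the degree of $g$ is at least $\frac{p-1}{2}$ or $g$ is a constant function.
   Context: $\mathbb{F}_p$ is the field of $p$ elements. Every function $\mathbb{F}_p \to \mathbb{F}_p$ is given by a unique polynomial of degree at most $p-1$, and the degree of such a function means the degree of this polynomial. Elements of $\mathbb{F}_p$ are identified with the integers $0,1,\ldots,p-1$, and the sum of the values of $g$ is taken in $\mathbb{Z}$ (not modulo $p$). *)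

(* Defs.v *)
From HB Require Import structures.
From mathcomp Require Import all_boot all_order all_algebra.

Set Implicit Arguments.
Unset Strict Implicit.
Unset Printing Implicit Defensive.

Import GRing.Theory.

Local Open Scope ring_scope.

(* The representative in {0, ..., p-1}; the underlying ordinal bound of 'F_p
   is p itself only when p is prime. *)
Definition repr_Fp (p : nat) (x : 'F_p) : nat := nat_of_ord x.

(* Main.v *)
Require Import Defs.
From HB Require Import structures.
From mathcomp Require Import all_boot all_order all_algebra.
From mathcomp Require Import fingroup cyclic finfield.
From mathcomp Require Import zify ring.

Set Implicit Arguments.
Unset Strict Implicit.
Unset Printing Implicit Defensive.

Import GRing.Theory.

Local Open Scope ring_scope.

(** Let [m i] be the integer representative of [g(i)] and put
    [P = \prod_i (X - i)^(m i)].  Its logarithmic derivative is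
    [\sum_i m i / (X - i)], and Lagrange interpolation rewrites this sum as
    [- g / (X^p - X)]; hence [(X^p - X) P' = - g P].  The sum of the [m i] being
    [p], we have [P = X^p + h] with [deg h < p], and [deg h <= deg g + 1] because
    [P' = h'] has the degree of [g].  If [deg g < (p-1)/2], then in
    [(h' + g) X^p = h' X - g h] the right-hand side has degree less than [p], so
    [h' = - g] and [h' (X + h) = 0]: either [g = 0], or [h = - X] and [g = 1]. *)

Lemma natr_card_finField (F : finFieldType) : #|F|%:R = 0 :> F.
Proof. by rewrite -FinRing.zmodXgE -cardsT expg_cardG ?inE. Qed.

(** Differentiate [X^q - X], the product of all [X - j], and evaluate at [i]: only the term omitting
    [X - i] survives on one side, and the other is -1 because [q = 0] in [F]. *)
Lemma prod_sub_neq (F : finFieldType) (i : F) :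
  \prod_(j | j != i) (i - j) = -1.
Proof.
have /(congr1 (fun q : {poly F} => q^`().[i])) := finField_genPoly F.
rewrite (bigD1 i) //= derivM !derivE !hornerE subrr mul0r addr0.
rewrite hornerMn -mulr_natr natr_card_finField mulr0 sub0r horner_prod => ->.
by apply: eq_bigr => j _; rewrite !hornerE.
Qed.

(** The logarithmic derivative with denominators cleared. The full product over [F] stays fixed
    while [r] varies, which lets induction on [r] go through. *)
Lemma log_deriv_prod_XsubC (F : finFieldType) (m : F -> nat) (r : seq F) :
  (\prod_i ('X - i%:P)) * (\prod_(i <- r) ('X - i%:P) ^+ m i)^`() =
  (\sum_(i <- r) (\prod_(j | j != i) ('X - j%:P)) *+ m i)
    * \prod_(i <- r) ('X - i%:P) ^+ m i.
Proof.
elim: r => [|a r IHr]; first by rewrite !big_nil derivE mulr0 mul0r.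
rewrite !big_cons derivM mulrDr [X in _ + X]mulrCA IHr mulrDl.
rewrite [X in _ = _ + X]mulrCA; congr (_ + _).
rewrite !mulrA; congr (_ * _).
(* The factor [X - a] of the full product restores the power lost by differentiation; if [m a = 0],
   both sides vanish. *)
rewrite deriv_exp derivXsubC mul1r (bigD1 a) //=.
case: (m a) => [|n]; first by rewrite !mulr0n mulr0 mul0r.
by rewrite mulrnAl mulrnAr mulrAC exprS mulrC mulrA.
Qed.

(** Both sides have degree below [#|F|] and agree on all of [F]: at [i] only the [i]-th summand is
    nonzero, and its product is -1 by [prod_sub_neq]. *)
Lemma lagrange_finField (F : finFieldType) (g : {poly F}) (m : F -> nat) :
  (size g <= #|F|)%N -> (forall i, (m i)%:R = g.[i]) ->
  \sum_i (\prod_(j | j != i) ('X - j%:P)) *+ m i = - g.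
Proof.
move=> size_g mE; apply/eqP; rewrite -subr_eq0 opprK; apply/eqP.
apply: (@roots_geq_poly_eq0 _ _ (enum F)); last 1 first.
- rewrite -cardE (leq_trans (size_polyD _ _)) // geq_max size_g andbT.
  apply: (leq_trans (size_sum _ _ _)); apply/bigmax_leqP => i _.
  rewrite -scaler_nat (leq_trans (size_scale_leq _ _)) //.
  have -> : \prod_(j | j != i) ('X - j%:P) = \prod_(j <- enum (predC1 i)) ('X - j%:P).
    by rewrite big_enum.
  by rewrite size_prod_XsubC -cardE cardC1 prednK //; apply/card_gt0P; exists i.
- apply/allP => i _; rewrite rootE hornerD horner_sum (bigD1 i) //=.
  rewrite [X in _ + X + _]big1 => [|j ji]; last first.
    by rewrite hornerMn horner_prod (bigD1 i) 1?eq_sym //= hornerXsubC subrr mul0r mul0rn.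
  rewrite addr0 hornerMn horner_prod.
  under eq_bigr do rewrite hornerXsubC.
  by rewrite prod_sub_neq mulNrn mE addNr.
- exact: enum_uniq.
Qed.

Lemma lacunary_deriv_eq (p : nat) (p_prime : prime p) (g h : {poly 'F_p}) :
  (size h <= p)%N -> ((size g).*2 < p)%N ->
  ('X^p - 'X) * h^`() = - g * ('X^p + h) ->
  g = 0 \/ g = 1.
Proof.
move=> size_h size_g E.
have [->|g0] := eqVneq g 0; first by left.
right.
(* Compare degrees in the hypothesis: both [X^p - X] and [X^p + h] have degree [p]. *)
have size_dh : (size h^`() <= size g)%N.
  have [->|dh0] := eqVneq h^`() 0; first by rewrite size_poly0.
  have p_gt1 := prime_gt1 p_prime.
  have size_D : size ('X^p - 'X : {poly 'F_p}) = p.+1.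
    by rewrite size_polyDl size_polyXn // size_polyN size_polyX.
  have size_F : (size ('X^p + h)%R <= p.+1)%N.
    by rewrite (leq_trans (size_polyD _ _)) // size_polyXn geq_max leqnn leqW.
  have size_l : size (('X^p - 'X) * h^`()) = (p + size h^`())%N.
    by rewrite size_mul ?size_D // -size_poly_gt0 size_D.
  have size_r : (size (- g * ('X^p + h))%R <= (size g + size ('X^p + h)%R).-1)%N.
    by rewrite -(size_polyN g) size_polyMleq.
  move: size_r; rewrite -E size_l.
  lia.
(* Below degree [p], differentiation multiplies each coefficient of positive index by a unit, so
   [h'] controls all of [h] but its constant term. *)
have size_h1 : (size h <= (size g).+1)%N.
  apply/leq_sizeP => -[//|k] lt_gk.
  have [le_pk|lt_kp] := leqP p k.+1.
    by rewrite nth_default // (leq_trans size_h).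
  have := coef_deriv h k; rewrite nth_default ?(leq_trans size_dh) //.
  move/esym/eqP; rewrite -mulr_natr mulf_eq0 => /orP[/eqP//|].
  by rewrite -(dvdn_pcharf (pchar_Fp p_prime)) gtnNdvd.
have E1 : (h^`() + g) * 'X^p = h^`() * 'X - g * h.
  apply/eqP; rewrite -subr_eq0; apply/eqP.
  have -> : (h^`() + g) * 'X^p - (h^`() * 'X - g * h) =
     ('X^p - 'X) * h^`() - - g * ('X^p + h) by ring.
  by rewrite E subrr.
have dhE : h^`() = - g.
  (* Otherwise the left side of [E1] has degree at least [p], whereas the right side has size at
     most twice that of [g]. *)
  apply/eqP; rewrite -addr_eq0; apply: contraT => nz.
  have size_l : (p < size ((h^`() + g) * 'X^p)%R)%N.
    by rewrite size_mulXn // -addn1 leq_add2l size_poly_gt0.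
  have size_r : (size (h^`() * 'X - g * h)%R <= (size g).*2)%N.
    rewrite (leq_trans (size_polyD _ _)) // geq_max size_polyN.
    have size_g_gt0 : (0 < size g)%N by rewrite size_poly_gt0.
    apply/andP; split; apply: (leq_trans (size_polyMleq _ _)).
      by rewrite size_polyX addn2 -addnn -addn1 leq_add.
    by rewrite -subn1 leq_subLR add1n -addnn -addnS leq_add2l.
  by move: size_l; rewrite E1 ltnNge (leq_trans size_r) // ltnW.
have /eqP : g * ('X + h) = 0.
  apply/eqP; rewrite -oppr_eq0 mulrDr opprD -mulNr -dhE.
  by rewrite -E1 dhE addNr mul0r.
rewrite mulf_eq0 (negPf g0) addrC addr_eq0 => /eqP hE.
by apply: oppr_inj; rewrite -dhE hE derivN derivX.
Qed.

Theorem theorem1p2 (p : nat) (p_prime : prime p) (p_odd : odd p)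
    (g : {poly 'F_p}) (size_g : (size g <= p)%N)
    (sum_g : (\sum_(i : 'F_p) repr_Fp g.[i])%N = p) :
  (p.-1./2 <= (size g).-1)%N \/ exists c : 'F_p, forall i : 'F_p, g.[i] = c.
Proof.
have [|deg_g] := leqP p.-1./2 (size g).-1; [by left|right].
pose m i := repr_Fp g.[i].
pose P : {poly 'F_p} := \prod_i ('X - i%:P) ^+ m i.
have mon_P : P \is monic by apply: monic_prod => i _; rewrite monic_exp ?monicXsubC.
(* The integer sum enters here, as the degree of [P]. *)
have size_P : size P = p.+1.
  rewrite size_prod => [|i _]; last by rewrite expf_neq0 ?polyXsubC_eq0.
  under eq_bigr do rewrite size_exp_XsubC -addn1.
  by rewrite big_split sum1_card /= -addSn addnK; congr _.+1.
have dP : ('X^p - 'X) * P^`() = - g * P.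
  rewrite -[- g](lagrange_finField (m := m)) ?card_Fp //.
    by rewrite -log_deriv_prod_XsubC -finField_genPoly card_Fp.
  by move=> i; rewrite /m /repr_Fp natr_Zp.
pose h := P - 'X^p.
have size_h : (size h <= p)%N.
  apply/leq_sizeP => k; rewrite leq_eqVlt coefB coefXn => /predU1P[<-|lt_pk].
    by rewrite eqxx -[X in P`_X]/(p.+1.-1) -size_P -lead_coefE (monicP mon_P) subrr.
  by rewrite gtn_eqF // subr0 nth_default // size_P.
have dh : h^`() = P^`().
  by rewrite derivB derivXn -scaler_nat pchar_Fp_0 // scale0r subr0.
have PE : P = 'X^p + h by rewrite addrC subrK.
case: (@lacunary_deriv_eq p p_prime g h) => //.
(* Degree below [(p-1)/2] means size at most [(p-1)/2], so the doubled size is at most [p-1]. *)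
- by have := prime_gt1 p_prime; lia.
- by rewrite dh dP -PE.
- by move=> ->; exists 0 => i; rewrite horner0.
- by move=> ->; exists 1 => i; rewrite hornerC.
Qed.
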